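(* Let $d\ge 3$, let $n_1,\dots,n_d$ and $\beta_1,\dots,\beta_d$ be positive integers, and set $\beta_0:=\beta_d$. For $i=1,\dots,d$ let $I_i\in\mathbb{R}^{n_i\times n_i}$ be the identity matrix, let $\mathbf{S}_i\in\mathbb{R}^{n_i\times n_i}$, let $L_{i,1},\dots,L_{i,\beta_i}\in\mathbb{R}^{n_i\times n_i}$, and let $M_{i,1},\dots,M_{i,\beta_{i-1}}\in\mathbb{R}^{n_i\times n_i}$ be arbitrary matrices. Let $[\mathbf{L}_i]$, $[\mathbf{M}_i]$, $[\mathbf{J}_i]$ be the arrays of matrices built from these as specified in the context, and write $\mathbf{I}_i=I_i$. Then the tensor-train operator (SLIM decomposition) $$ \begin{bmatrix}\mathbf{S}_1 & \mathbf{L}_1 & \mathbf{I}_1 & \mathbf{M}_1\end{bmatrix} \otimes \begin{bmatrix}\mathbf{I}_2&0&0&0\\ \mathbf{M}_2&0&0&0\\ \mathbf{S}_2&\mathbf{L}_2&\mathbf{I}_2&0\\ 0&0&0&\mathbf{J}_2\end{bmatrix} \otimes\cdots\otimes \begin{bmatrix}\mathbf{I}_{d-1}&0&0&0\\ \mathbf{M}_{d-1}&0&0&0\\ \mathbf{S}_{d-1}&\mathbf{L}_{d-1}&\mathbf{I}_{d-1}&0\\ 0&0&0&\mathbf{J}_{d-1}\end{bmatrix} \otimes \begin{bmatrix}\mathbf{I}_d\\ \mathbf{M}_d\\ \mathbf{S}_d\\ \mathbf{L}_d\end{bmatrix} $$ is equal to the operator $$ \begin{aligned} \mathbf{A}={}&\mathbf{S}_1\otimes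 I_2\otimes\cdots\otimes I_d+\cdots+I_1\otimes\cdots\otimes I_{d-1}\otimes\mathbf{S}_d\\ &+[\mathbf{L}_1]\otimes[\mathbf{M}_2]\otimes I_3\otimes\cdots\otimes I_d+\cdots+I_1\otimes\cdots\otimes I_{d-2}\otimes[\mathbf{L}_{d-1}]\otimes[\mathbf{M}_d]\\ &+[\mathbf{M}_1]\otimes[\mathbf{J}_2]\otimes\cdots\otimes[\mathbf{J}_{d-1}]\otimes[\mathbf{L}_d] \end{aligned} $$ in $\mathbb{R}^{(n_1\times n_1)\times\cdots\times(n_d\times n_d)}$. In the first line the $i$-th summand has $\mathbf{S}_i$ in position $i$ and identities elsewhere ($i=1,\dots,d$); in the second line the $i$-th summand has $[\mathbf{L}_i]\otimes[\mathbf{M}_{i+1}]$ in positions $i,i+1$ and identities elsewhere ($i=1,\dots,d-1$).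
   Context: Tensor product: for real multidimensional arrays $\mathbf{T},\mathbf{U}$, $(\mathbf{T}\otimes\mathbf{U})_{x,y}=\mathbf{T}_x\mathbf{U}_y$ (outer product of arrays; index tuples are concatenated). An element $\mathbf{A}\in\mathbb{R}^{(n_1\times n_1)\times\cdots\times(n_d\times n_d)}$ has entries $\mathbf{A}_{x_1,y_1,\dots,x_d,y_d}$ with $x_i,y_i\in\{1,\dots,n_i\}$. Core notation: a TT core $\mathbf{A}^{(i)}\in\mathbb{R}^{r_{i-1}\times n_i\times n_i\times r_i}$ is written as an $r_{i-1}\times r_i$ array $[\mathbf{A}^{(i)}]$ whose $(k,l)$ element is the matrix $\mathbf{A}^{(i)}_{k,:,:,l}\in\mathbb{R}^{n_i\times n_i}$. The product $[\mathbf{A}^{(i)}]\otimes[\mathbf{A}^{(i+1)}]$ is formed like a matrix product in which elements are multiplied by the tensor product: its $(k,m)$ element is $\sum_{l=1}^{r_i}\mathbf{A}^{(i)}_{k,:,:,l}\otimes\mathbf{A}^{(i+1)}_{l,:,:,m}$. Thus $[\mathbf{A}^{(1)}]\otimes\cdots\otimes[\mathbf{A}^{(d)}]$, with $r_0=r_d=1$, denotes the operator $\sum_{k_0=1}^{r_0}\cdots\sum_{k_d=1}^{r_d}\mathbf{A}^{(1)}_{k_0,:,:,k_1}\otimes\cdots\otimes\mathbf{A}^{(d)}_{k_{d-1},:,:,k_d}$. A single matrix is regarded as a $1\times1$ array. The arrays: for $i=1,\dots,d-1$, $[\mathbf{L}_i]=[L_{i,1}\ \cdots\ L_{i,\beta_i}]$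 is a $1\times\beta_i$ row of matrices and $[\mathbf{M}_{i+1}]$ is the $\beta_i\times1$ column with elements $M_{i+1,1},\dots,M_{i+1,\beta_i}$; $[\mathbf{L}_d]$ is the $\beta_d\times 1$ column with elements $L_{d,1},\dots,L_{d,\beta_d}$; $[\mathbf{M}_1]=[M_{1,1}\ \cdots\ M_{1,\beta_d}]$ is a $1\times\beta_d$ row; for $2\le i\le d-1$, $[\mathbf{J}_i]$ is the $\beta_d\times\beta_d$ array with $I_i$ on the diagonal and zero matrices off the diagonal. (Only the elements inside the arrays are arranged as rows or columns; the matrices themselves are not transposed.) Supercores: the displayed bracketed arrays in the SLIM decomposition are obtained by placing these arrays as blocks, the symbol $0$ denoting a block of zero matrices of the appropriate size. So the first core is a $1\times(2+\beta_1+\beta_d)$ array; the $i$-th core ($2\le i\le d-1$) has row blocks of sizes $1,\beta_{i-1},1,\beta_d$ and column blocks of sizes $1,\beta_i,1,\beta_d$; the last core is a $(2+\beta_{d-1}+\beta_d)\times1$ array. *)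

(* Defs.v *)
From HB Require Import structures.
From mathcomp Require Import all_boot all_order all_algebra.
From mathcomp Require Import reals.

Set Implicit Arguments.
Unset Strict Implicit.
Unset Printing Implicit Defensive.

Import GRing.Theory.
Local Open Scope ring_scope.

(* Index tuples of a multidimensional array of shape [s]: a nested product
   ['I_n1 * ('I_n2 * ... * unit)]. *)
Fixpoint idx (s : seq nat) : finType :=
  if s is n :: s' then ('I_n * idx s')%type : finType else unit.

Notation array R s := {ffun idx s -> R}.

Fixpoint icat (s t : seq nat) : idx s -> idx t -> idx (s ++ t) :=
  if s is n :: s' return idx s -> idx t -> idx (s ++ t)
  then fun x y => (x.1, icat x.2 y)
  else fun _ y => y.

Fixpoint isplit (s t : seq nat) : idx (s ++ t) -> idx s * idx t :=
  if s is n :: s' return idx (s ++ t) -> idx s * idx t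
  then fun z => let xy := isplit z.2 in ((z.1, xy.1), xy.2)
  else fun z => (tt, z).

Definition tens (R : nzRingType) (s t : seq nat)
    (T : array R s) (U : array R t) : array R (s ++ t) :=
  [ffun z => T (isplit z).1 * U (isplit z).2].

Lemma icatK (s t : seq nat) (x : idx s) (y : idx t) :
  isplit (icat x y) = (x, y).
Proof. by elim: s x => [[]|n s IHs [a x]] //=; rewrite IHs. Qed.

Lemma tensE (R : nzRingType) (s t : seq nat) (T : array R s) (U : array R t)
    (x : idx s) (y : idx t) :
  tens T U (icat x y) = T x * U y.
Proof. by rewrite ffunE icatK. Qed.

Definition mx_array (R : nzRingType) (n : nat) (A : 'M[R]_n) :
    array R [:: n; n] :=
  [ffun z => A z.1 z.2.1].

(* A bracketed array [A] whose elements are real arrays of shape [s]. *)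
Record bracket (R : nzRingType) (s : seq nat) := Bracket {
  rowrank : nat;
  colrank : nat;
  elts : 'M[array R s]_(rowrank, colrank) }.

(* A TT core, given as an array of n x n matrices. *)
Definition core (R : nzRingType) (n r p : nat) (A : 'M['M[R]_n]_(r, p)) :
    bracket R [:: n; n] :=
  Bracket (map_mx (@mx_array R n) A).

(* The product of bracketed arrays.  It is meaningful when the inner ranks
   agree, in which case [conform_mx] is the identity on [elts B] (see
   [brmulE]); otherwise [conform_mx] replaces [elts B] by zero. *)
Definition brmul (R : nzRingType) (s t : seq nat)
    (A : bracket R s) (B : bracket R t) : bracket R (s ++ t) :=
  let B' := conform_mx (0 : 'M_(colrank A, colrank B)) (elts B) in
  Bracket (\matrix_(k < rowrank A, m < colrank B)
             \sum_(l < colrank A) tens (elts A k l) (B' l m)).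

Lemma brmulE (R : nzRingType) (s t : seq nat) (r q p : nat)
    (A : 'M[array R s]_(r, q)) (B : 'M[array R t]_(q, p)) :
  brmul (Bracket A) (Bracket B) =
  Bracket (\matrix_(k, m) \sum_l tens (A k l) (B l m)).
Proof. by rewrite /brmul /= conform_mx_id. Qed.

(* (n_1, n_1, ..., n_d, n_d) *)
Fixpoint opshape (n : nat -> nat) (d : nat) : seq nat :=
  if d is d'.+1 then opshape n d' ++ [:: n d; n d] else [::].

(* [G_1] (x) ... (x) [G_d]; the empty product is the 1 x 1 array whose element
   is the order-0 array 1. *)
Fixpoint brprod (R : nzRingType) (n : nat -> nat)
    (G : forall i, bracket R [:: n i; n i]) (d : nat) :
    bracket R (opshape n d) :=
  if d is d'.+1 return bracket R (opshape n d)
  then brmul (brprod G d') (G d'.+1)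
  else Bracket (const_mx [ffun=> 1] : 'M_1).

(* The operator denoted by a tensor train [G_1] (x) ... (x) [G_d] with
   r_0 = r_d = 1. *)
Definition ttop (R : nzRingType) (n : nat -> nat)
    (G : forall i, bracket R [:: n i; n i]) (d : nat) : array R (opshape n d) :=
  \sum_(k < rowrank (brprod G d)) \sum_(l < colrank (brprod G d))
    elts (brprod G d) k l.

Definition arr1 (R : nzRingType) (n : nat) (A : 'M[R]_n) : 'M['M[R]_n]_1 :=
  const_mx A.

Definition arr_row (R : nzRingType) (n b : nat) (A : 'I_b -> 'M[R]_n) :
    'M['M[R]_n]_(1, b) :=
  \row_k A k.

Definition arr_col (R : nzRingType) (n b : nat) (A : 'I_b -> 'M[R]_n) :
    'M['M[R]_n]_(b, 1) :=
  \col_k A k.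

Definition arrJ (R : nzRingType) (n b : nat) : 'M['M[R]_n]_b :=
  \matrix_(k, l) if k == l then 1%:M else 0.

(* In the three supercores below [c] stands for beta_d. *)
Definition slim_first (R : nzRingType) (n b c : nat) (S1 : 'M[R]_n)
    (L1 : 'I_b -> 'M[R]_n) (M1 : 'I_c -> 'M[R]_n) :
    'M['M[R]_n]_(1, 1 + (b + (1 + c))) :=
  row_mx (arr1 S1) (row_mx (arr_row L1) (row_mx (arr1 1%:M) (arr_row M1))).

Definition slim_mid (R : nzRingType) (n a b c : nat) (Si : 'M[R]_n)
    (Li : 'I_b -> 'M[R]_n) (Mi : 'I_a -> 'M[R]_n) :
    'M['M[R]_n]_(1 + (a + (1 + c)), 1 + (b + (1 + c))) :=
  col_mx (row_mx (arr1 1%:M)  (row_mx 0            (row_mx 0           0)))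
 (col_mx (row_mx (arr_col Mi) (row_mx 0            (row_mx 0           0)))
 (col_mx (row_mx (arr1 Si)    (row_mx (arr_row Li) (row_mx (arr1 1%:M) 0)))
         (row_mx 0            (row_mx 0            (row_mx 0 (arrJ R n c)))))).

Definition slim_last (R : nzRingType) (n a c : nat) (Sd : 'M[R]_n)
    (Ld : 'I_c -> 'M[R]_n) (Md : 'I_a -> 'M[R]_n) :
    'M['M[R]_n]_(1 + (a + (1 + c)), 1) :=
  col_mx (arr1 1%:M) (col_mx (arr_col Md) (col_mx (arr1 Sd) (arr_col Ld))).

(* [M 1] is indexed by 'I_(beta 0); the ranks of consecutive supercores match
   under the convention beta_0 = beta_d. *)
Definition slim_core (R : nzRingType) (d : nat) (n beta : nat -> nat)
    (S_ : forall i, 'M[R]_(n i))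
    (L : forall i, 'I_(beta i) -> 'M[R]_(n i))
    (M : forall i, 'I_(beta i.-1) -> 'M[R]_(n i))
    (i : nat) : bracket R [:: n i; n i] :=
  if i == 1%N then core (slim_first (S_ i) (L i) (M i))
  else if i == d then core (slim_last (S_ i) (L i) (M i))
  else core (slim_mid (beta d) (S_ i) (L i) (M i)).

Lemma slim_core_ranks (R : nzRingType) (d : nat) (n beta : nat -> nat)
    (S_ : forall i, 'M[R]_(n i))
    (L : forall i, 'I_(beta i) -> 'M[R]_(n i))
    (M : forall i, 'I_(beta i.-1) -> 'M[R]_(n i)) :
  (3 <= d)%N -> beta 0%N = beta d ->
  [/\ rowrank (slim_core d S_ L M 1) = 1%N,
      colrank (slim_core d S_ L M d) = 1%N
    & forall i, (1 <= i < d)%N ->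
        colrank (slim_core d S_ L M i) = rowrank (slim_core d S_ L M i.+1)].
Proof.
case: d => [|[|d]] // _ b0; rewrite /slim_core; split=> //=.
  by rewrite eqxx.
case=> [|[|i]] //= lt_id; first by rewrite b0; case: ifP => //= /eqP <-.
by rewrite ltn_eqF //=; case: ifP => //= /eqP <-.
Qed.

(* Main.v *)
Require Import Defs.
From HB Require Import structures.
From mathcomp Require Import all_boot all_order all_algebra.
From mathcomp Require Import reals.

Set Implicit Arguments.
Unset Strict Implicit.
Unset Printing Implicit Defensive.

Import GRing.Theory.
Local Open Scope ring_scope.

(** Multiply the supercores from left to right.  After the i-th factor
    (1 <= i < d) the accumulated row has four blocks: the part of [A] supported
    on sites 1..i, the pending coupling [I (x) ... (x) I (x) L_i], the identity
    [I (x) ... (x) I], and the pending cyclic coupling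
    [M_1 (x) J_2 (x) ... (x) J_i].  Each middle supercore preserves this shape,
    and the last one contracts the four blocks into the three lines of [A]. *)

(** * Block calculus for products of bracketed arrays *)

Section BracketProduct.
Variable R : nzRingType.

Lemma tensDl (s t : seq nat) (T1 T2 : array R s) (U : array R t) :
  tens (T1 + T2) U = tens T1 U + tens T2 U.
Proof. by apply/ffunP=> z; rewrite !ffunE mulrDl. Qed.

Lemma tens0l (s t : seq nat) (U : array R t) : tens (0 : array R s) U = 0.
Proof. by apply/ffunP=> z; rewrite !ffunE mul0r. Qed.

Lemma tens0r (s t : seq nat) (T : array R s) : tens T (0 : array R t) = 0.
Proof. by apply/ffunP=> z; rewrite !ffunE mulr0. Qed.

Lemma tens_suml (s t : seq nat) (I : Type) (r : seq I) (P : pred I)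
    (F : I -> array R s) (U : array R t) :
  tens (\sum_(i <- r | P i) F i) U = \sum_(i <- r | P i) tens (F i) U.
Proof.
by apply: (big_morph (fun T => tens T U)) => [T1 T2|]; rewrite ?tensDl ?tens0l.
Qed.

(** The elements of [brmul] when the inner ranks agree by typing: no [conform_mx] remains, so block
    decompositions apply directly. *)
Definition tensmx (s t : seq nat) (r q p : nat)
    (A : 'M[array R s]_(r, q)) (B : 'M[array R t]_(q, p)) :
    'M[array R (s ++ t)]_(r, p) :=
  \matrix_(k, m) \sum_l tens (A k l) (B l m).

Lemma tensmx0 (s t : seq nat) (r q p : nat) (A : 'M[array R s]_(r, q)) :
  tensmx A (0 : 'M[array R t]_(q, p)) = 0.
Proof.
by apply/matrixP=> k m; rewrite !mxE big1 // => l _; rewrite mxE tens0r.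
Qed.

Lemma tensmx_const (s t : seq nat) (a : array R s) (b : array R t) :
  tensmx (const_mx a : 'M_1) (const_mx b : 'M_1) = const_mx (tens a b).
Proof. by apply/matrixP=> k m; rewrite !mxE big_ord1 !mxE. Qed.

Lemma tensmx_row (s t : seq nat) (r q p1 p2 : nat) (A : 'M[array R s]_(r, q))
    (B1 : 'M[array R t]_(q, p1)) (B2 : 'M[array R t]_(q, p2)) :
  tensmx A (row_mx B1 B2) = row_mx (tensmx A B1) (tensmx A B2).
Proof.
apply/matrixP=> k m; rewrite !mxE; case: split_ordP => j ->;
  by rewrite mxE; apply: eq_bigr => l _; rewrite ?row_mxEl ?row_mxEr.
Qed.

Lemma tensmx_row_col (s t : seq nat) (r q1 q2 p : nat)
    (A1 : 'M[array R s]_(r, q1)) (A2 : 'M[array R s]_(r, q2))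
    (B1 : 'M[array R t]_(q1, p)) (B2 : 'M[array R t]_(q2, p)) :
  tensmx (row_mx A1 A2) (col_mx B1 B2) = tensmx A1 B1 + tensmx A2 B2.
Proof.
apply/matrixP=> k m; rewrite !mxE big_split_ord /=.
by congr (_ + _); apply: eq_bigr => l _;
  rewrite ?row_mxEl ?row_mxEr ?col_mxEu ?col_mxEd.
Qed.

Lemma map_mx_array0 (n r p : nat) :
  map_mx (@mx_array R n) (0 : 'M_(r, p)) = 0.
Proof. by apply/matrixP=> i j; rewrite !mxE; apply/ffunP=> z; rewrite !ffunE mxE. Qed.

Lemma brmul_core (s : seq nat) (n r q p : nat)
    (A : 'M[array R s]_(r, q)) (B : 'M['M[R]_n]_(q, p)) :
  brmul (Bracket A) (core B) = Bracket (tensmx A (map_mx (@mx_array R n) B)).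
Proof. exact: brmulE. Qed.

(** * Tensor trains extended by one core *)

Variable n : nat -> nat.
Implicit Types G : forall i, bracket R [:: n i; n i].

Lemma eq_brprod G G' (d : nat) :
  (forall i, (1 <= i <= d)%N -> G i = G' i) -> brprod G d = brprod G' d.
Proof.
elim: d => //= d IHd eqG; rewrite (eqG d.+1) ?leqnn // IHd // => i /andP[i1 id].
by apply: eqG; rewrite i1 leqW.
Qed.

Lemma eq_ttop G G' (d : nat) :
  (forall i, (1 <= i <= d)%N -> G i = G' i) -> ttop G d = ttop G' d.
Proof. by move=> /eq_brprod eqG; rewrite /ttop eqG. Qed.

Lemma ttopE G (d : nat) (A : 'M[array R (opshape n d)]_1) :
  brprod G d = Bracket A -> ttop G d = A 0 0.
Proof. by move=> defG; rewrite /ttop defG /= !big_ord1. Qed.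

(** Expresses that both outer ranks are 1. Ranks are fields of a computed record, so this is an
    equality of brackets, which can be rewritten inside a longer product. *)
Definition closed_brprod G (d : nat) :=
  brprod G d = Bracket (const_mx (ttop G d) : 'M_1).

Lemma brprod_closed G (d : nat) (A : 'M[array R (opshape n d)]_1) :
  brprod G d = Bracket A -> closed_brprod G d.
Proof.
move=> defG; rewrite /closed_brprod (ttopE defG) defG; congr Bracket.
by apply/matrixP=> i j; rewrite !ord1 mxE.
Qed.

Lemma closed_brprod0 G : closed_brprod G 0.
Proof. exact: (@brprod_closed G 0). Qed.

Lemma brprodS G (d r q p : nat) (A : 'M[array R (opshape n d)]_(r, q))
    (B : 'M['M[R]_(n d.+1)]_(q, p)) :
    brprod G d = Bracket A -> G d.+1 = core B ->
  brprod G d.+1 =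
    Bracket (tensmx A (map_mx (@mx_array R (n d.+1)) B) :
               'M[array R (opshape n d.+1)]_(r, p)).
Proof. by move=> /= -> ->; rewrite brmul_core. Qed.

Lemma brprodS_arr1 G (d : nat) (X : 'M[R]_(n d.+1)) :
    closed_brprod G d -> G d.+1 = core (arr1 X) ->
  brprod G d.+1 = Bracket (const_mx (tens (ttop G d) (mx_array X)) : 'M_1).
Proof.
by move=> clG GX; rewrite (brprodS clG GX) map_const_mx tensmx_const.
Qed.

Lemma closed_brprodS G (d : nat) (X : 'M[R]_(n d.+1)) :
  closed_brprod G d -> G d.+1 = core (arr1 X) -> closed_brprod G d.+1.
Proof. by move=> clG GX; apply: brprod_closed (brprodS_arr1 clG GX). Qed.

Lemma ttopS_arr1 G (d : nat) (X : 'M[R]_(n d.+1)) :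
    closed_brprod G d -> G d.+1 = core (arr1 X) ->
  ttop G d.+1 = tens (ttop G d) (mx_array X).
Proof. by move=> clG GX; rewrite (ttopE (brprodS_arr1 clG GX)) mxE. Qed.

End BracketProduct.

(** * Recursions for the local and nearest-neighbour sums *)

Section Slim.
Variables (R : nzRingType) (n beta : nat -> nat).
Variable S_ : forall i, 'M[R]_(n i).
Variable L : forall i, 'I_(beta i) -> 'M[R]_(n i).
Variable M : forall i, 'I_(beta i.-1) -> 'M[R]_(n i).

Arguments L : clear implicits.
Arguments M : clear implicits.

Local Notation mxa k := (@mx_array R (n k)).

Definition id_cores (j : nat) : bracket R [:: n j; n j] :=
  core (arr1 (1%:M : 'M[R]_(n j))).

Definition site_cores (i j : nat) : bracket R [:: n j; n j] :=
  if j == i then core (arr1 (S_ j)) else core (arr1 (1%:M : 'M[R]_(n j))).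

Definition pair_cores (i j : nat) : bracket R [:: n j; n j] :=
  if j == i then core (arr_row (L j))
  else if j == i.+1 then core (arr_col (M j))
  else core (arr1 (1%:M : 'M[R]_(n j))).

Definition cyclic_cores (d j : nat) : bracket R [:: n j; n j] :=
  if j == 1%N then core (arr_row (M j))
  else if j == d then core (arr_col (L j))
  else core (arrJ R (n j) (beta d)).

(** The pending coupling on [d.+1] sites: [d] identities, then the row of matrices [L d.+1], still
    waiting for its column [M d.+2]. *)
Definition pair_left (d : nat) :
    'M[array R (opshape n d.+1)]_(1, beta d.+1) :=
  tensmx (const_mx (ttop id_cores d) : 'M_1)
         (map_mx (mxa d.+1) (arr_row (L d.+1))).

Definition site_sum (d : nat) := \sum_(1 <= i < d.+1) ttop (site_cores i) d.

Definition pair_sum (d : nat) := \sum_(1 <= i < d) ttop (pair_cores i) d.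

Lemma id_cores_closed (d : nat) : closed_brprod id_cores d.
Proof.
by elim: d => [|d IHd]; [exact: closed_brprod0 | exact: closed_brprodS].
Qed.

Lemma id_coresS (d : nat) :
  ttop id_cores d.+1 = tens (ttop id_cores d) (mxa d.+1 1%:M).
Proof. exact: ttopS_arr1 (id_cores_closed d) _. Qed.

Lemma site_cores_closed (i d : nat) : closed_brprod (site_cores i) d.
Proof.
elim: d => [|d IHd]; first exact: closed_brprod0.
case: (eqVneq d.+1 i) => [di|/negPf di].
  by apply: (closed_brprodS (X := S_ d.+1) IHd); rewrite /site_cores di eqxx.
by apply: (closed_brprodS (X := 1%:M) IHd); rewrite /site_cores di.
Qed.

(** The old summands gain an identity at the new site; the only new summand has [S_] there, after
    identities. *)
Lemma site_sumS (d : nat) :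
  site_sum d.+1 = tens (site_sum d) (mxa d.+1 1%:M)
                  + tens (ttop id_cores d) (mxa d.+1 (S_ d.+1)).
Proof.
rewrite /site_sum big_nat_recr //= tens_suml; congr (_ + _).
  apply: eq_big_nat => i /andP[_ id].
  apply: ttopS_arr1 (site_cores_closed i d) _.
  by rewrite /site_cores gtn_eqF.
rewrite (ttopS_arr1 (X := S_ d.+1) (site_cores_closed _ d)); last first.
  by rewrite /site_cores eqxx.
congr tens; apply: eq_ttop => j /andP[_ jd].
by rewrite /site_cores ltn_eqF.
Qed.

Lemma brprod_pair_left (d : nat) :
  brprod (pair_cores d.+1) d.+1 = Bracket (pair_left d).
Proof.
apply: brprodS; last by rewrite /pair_cores eqxx.
(* All sites before [d.+1] carry identities, so the prefix is the identity train. *)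
rewrite -id_cores_closed; apply: eq_brprod => j /andP[_ jd].
by rewrite /pair_cores !ltn_eqF // ltnS leqW.
Qed.

Lemma brprod_pair (d : nat) :
  brprod (pair_cores d.+1) d.+2 =
  Bracket (tensmx (pair_left d) (map_mx (mxa d.+2) (arr_col (M d.+2)))
           : 'M[array R (opshape n d.+2)]_1).
Proof.
apply: brprodS (brprod_pair_left d) _.
by rewrite /pair_cores gtn_eqF // eqxx.
Qed.

Lemma pair_cores_far (i d : nat) : (i.+1 < d)%N ->
  pair_cores i d = core (arr1 1%:M).
Proof. by move=> id; rewrite /pair_cores !gtn_eqF // ltnW. Qed.

(** The bound [i < d] ensures that site [i.+1] is included: a train stopped at site [i] still has
    the open row of [L i]. *)
Lemma pair_cores_closed (i d : nat) :
  (0 < i < d)%N -> closed_brprod (pair_cores i) d.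
Proof.
case: i => // i /=; elim: d => // d IHd; rewrite ltnS leq_eqVlt => /predU1P[<-|id].
  exact: brprod_closed (brprod_pair i).
by apply: closed_brprodS (IHd id) _; rewrite pair_cores_far.
Qed.

Lemma pair_sumS (d : nat) :
  pair_sum d.+2 = tens (pair_sum d.+1) (mxa d.+2 1%:M)
    + tensmx (pair_left d) (map_mx (mxa d.+2) (arr_col (M d.+2))) 0 0.
Proof.
rewrite /pair_sum big_nat_recr //= tens_suml; congr (_ + _).
  apply: eq_big_nat => i id.
  apply: ttopS_arr1 (pair_cores_closed id) _.
  by apply: pair_cores_far; case/andP: id.
exact: ttopE (brprod_pair d).
Qed.

(** The first column block of a middle supercore, and likewise the rows above [L] in the last one:
    finished terms meet the identity, the pending coupling meets [M], and the identity train meets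
    [S_]. *)
Lemma const_mx_site_pair_sumS (d : nat) :
  const_mx (tens (site_sum d.+1 + pair_sum d.+1) (mxa d.+2 1%:M))
  + (tensmx (pair_left d) (map_mx (mxa d.+2) (arr_col (M d.+2)))
     + const_mx (tens (ttop id_cores d.+1) (mxa d.+2 (S_ d.+2))))
  = const_mx (site_sum d.+2 + pair_sum d.+2) :> 'M_1.
Proof.
apply/matrixP=> i j; rewrite !ord1 pair_sumS (site_sumS d.+1) tensDl !mxE.
by rewrite [X in _ + X]addrC addrACA.
Qed.

(** * Propagation of the accumulated row through the supercores *)

Lemma pair_sum1 : pair_sum 1 = 0.
Proof. by rewrite /pair_sum big_geq. Qed.

Lemma site_sum0 : site_sum 0 = 0.
Proof. by rewrite /site_sum big_geq. Qed.

(** The cyclic block [W] is left arbitrary, since the supercores act on it independently of the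
    other three blocks. *)
Definition slim_row (d c : nat) (W : 'M[array R (opshape n d.+1)]_(1, c)) :
    'M[array R (opshape n d.+1)]_(1, 1 + (beta d.+1 + (1 + c))) :=
  row_mx (const_mx (site_sum d.+1 + pair_sum d.+1))
 (row_mx (pair_left d)
 (row_mx (const_mx (ttop id_cores d.+1)) W)).

Lemma tensmx_slim_first :
  tensmx (const_mx (ttop id_cores 0) : 'M_1)
    (map_mx (mxa 1) (slim_first (S_ 1) (L 1) (M 1))) =
  slim_row (d := 0) (tensmx (const_mx (ttop id_cores 0) : 'M_1)
                       (map_mx (mxa 1) (arr_row (M 1)))).
Proof.
rewrite /slim_first !map_row_mx !tensmx_row !map_const_mx !tensmx_const.
rewrite /slim_row site_sumS site_sum0 pair_sum1 tens0l add0r addr0 -/(pair_left 0).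
by rewrite -id_coresS.
Qed.

(** Column by column: the first gathers the finished terms, the second and third are fed only by the
    identity train, and the fourth only by [W]. *)
Lemma tensmx_slim_mid (d c : nat) (W : 'M[array R (opshape n d.+1)]_(1, c)) :
  tensmx (slim_row W)
    (map_mx (mxa d.+2) (slim_mid c (S_ d.+2) (L d.+2) (M d.+2))) =
  slim_row (d := d.+1) (tensmx W (map_mx (mxa d.+2) (arrJ R (n d.+2) c))).
Proof.
rewrite /slim_mid !map_col_mx !map_row_mx !map_mx_array0 !tensmx_row_col.
rewrite !tensmx_row !tensmx0 !add_row_mx !addr0 !add0r !map_const_mx.
rewrite !tensmx_const -id_coresS -/(pair_left d.+1) /slim_row.
by rewrite const_mx_site_pair_sumS.
Qed.

Lemma tensmx_slim_last (d c : nat) (W : 'M[array R (opshape n d.+1)]_(1, c))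
    (Ld : 'I_c -> 'M[R]_(n d.+2)) :
  tensmx (slim_row W)
    (map_mx (mxa d.+2) (slim_last (S_ d.+2) Ld (M d.+2))) =
  const_mx (site_sum d.+2 + pair_sum d.+2)
  + tensmx W (map_mx (mxa d.+2) (arr_col Ld)).
Proof.
rewrite /slim_last !map_col_mx !tensmx_row_col !map_const_mx !tensmx_const.
by rewrite -const_mx_site_pair_sumS !addrA.
Qed.

(* The width [c] is abstract because it is [beta 0] for the first core and
   [beta d] for the others: equal, but not convertible. *)
Lemma brprod_slim (d i : nat) :
    beta 0 = beta d -> (i.+1 < d)%N ->
  exists (c : nat) (W : 'M[array R (opshape n i.+1)]_(1, c)),
    [/\ c = beta d, brprod (cyclic_cores d) i.+1 = Bracket W
      & brprod (slim_core d S_ L M) i.+1 = Bracket (slim_row W)].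
Proof.
move=> b0; elim: i => [|i IHi] lt_id.
  exists (beta 0), (tensmx (const_mx (ttop id_cores 0) : 'M_1)
                       (map_mx (mxa 1) (arr_row (M 1)))).
  (* The empty product does not depend on the cores, so [id_cores] can stand for any family. *)
  have E0 G : brprod G 0 = Bracket (const_mx (ttop id_cores 0) : 'M_1).
    exact: (id_cores_closed 0).
  split=> //; first exact: brprodS (E0 _) _.
  by rewrite -tensmx_slim_first; apply: brprodS (E0 _) _.
(* Substituting the width makes the type of [W] fit the block [arrJ] of width [beta d]. *)
have [c [W [cd Wcyc Wslim]]] := IHi (ltnW lt_id); subst c.
exists (beta d), (tensmx W (map_mx (mxa i.+2) (arrJ R (n i.+2) (beta d)))).
split=> //.
  by apply: brprodS Wcyc _; rewrite /cyclic_cores /= ltn_eqF.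
by rewrite -tensmx_slim_mid; apply: brprodS Wslim _; rewrite /slim_core /= ltn_eqF.
Qed.

End Slim.

Theorem theoremB1 (R : realType) (d : nat) (n beta : nat -> nat)
    (S_ : forall i, 'M[R]_(n i))
    (L : forall i, 'I_(beta i) -> 'M[R]_(n i))
    (M : forall i, 'I_(beta i.-1) -> 'M[R]_(n i))
    (d_ge3 : (3 <= d)%N)
    (n_gt0 : forall i, (1 <= i <= d)%N -> (0 < n i)%N)
    (beta_gt0 : forall i, (1 <= i <= d)%N -> (0 < beta i)%N)
    (beta0 : beta 0%N = beta d) :
  ttop (slim_core d S_ L M) d =
    \sum_(1 <= i < d.+1)
       ttop (fun j => if j == i then core (arr1 (S_ j))
                      else core (arr1 (1%:M : 'M[R]_(n j)))) d
  + \sum_(1 <= i < d)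
       ttop (fun j => if j == i then core (arr_row (L j))
                      else if j == i.+1 then core (arr_col (M j))
                      else core (arr1 (1%:M : 'M[R]_(n j)))) d
  + ttop (fun j => if j == 1%N then core (arr_row (M j))
                   else if j == d then core (arr_col (L j))
                   else core (arrJ R (n j) (beta d))) d.
Proof.
case: d d_ge3 n_gt0 beta_gt0 beta0 => [|[|d]] // _ _ _ beta0.
(* With [d.+2] sites in total, this covers every core but the last. *)
have [c [W [cd Wcyc Wslim]]] := brprod_slim S_ L M beta0 (ltnSn d.+1); subst c.
have cycd : cyclic_cores L M d.+2 d.+2 = core (arr_col (L d.+2)).
  by rewrite /cyclic_cores /= eqxx.
have slimd : slim_core d.+2 S_ L M d.+2
             = core (slim_last (S_ d.+2) (L d.+2) (M d.+2)).
  by rewrite /slim_core /= eqxx.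
rewrite (ttopE (brprodS Wslim slimd)) tensmx_slim_last mxE [X in X + _]mxE.
(* The same [W] is the cyclic train without its last core, so contracting it with the column of
   [L d.+2] gives the third line of the operator. *)
by congr (_ + _); rewrite -(ttopE (brprodS Wcyc cycd)).
Qed.
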